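(* Let $(Y,\sigma)$ be a Hausdorff $T_3$-space. For every topological space $(X,\tau)$ let $C(X,Y)$ be equipped with the compact-open topology. Let $\mathcal{B}$ be a class of topological spaces that contains the Stone-Čech compactification of a discrete space of cardinality at least $\mathrm{card}(Y)$. Then the Vietoris topology $\sigma_V$ on $K(Y)$ is the final topology with respect to all maps $$e_{X,A}: C(X,Y)\to K(Y),\quad f\mapsto f(A),\qquad (X,\tau)\in\mathcal{B},\ A\in K(X).$$
   Context: For a topological space $X$, $K(X)$ denotes the set of all nonempty compact subsets of $X$ (compact means every open cover has a finite subcover; no separation is implied), and $C(X,Y)$ is the set of continuous maps $X\to Y$. $T_3$ means: for every closed set $F$ and every point $y\notin F$ there are disjoint open sets $U\ni y$ and $V\supseteq F$. The compact-open topology on $C(X,Y)$ has the subbase of all sets $\{f\in C(X,Y): f(A)\subseteq W\}$ with $A\subseteq X$ compact and $W\subseteq Y$ open. The Vietoris topology $\sigma_V$ on $K(Y)$ has the subbase consisting of all sets $\{B\in K(Y): B\cap O\neq\emptyset\}$ and $\{B\in K(Y): B\subseteq O\}$ with $O\in\sigma$. The final topology on $K(Y)$ with respect to a class of maps into $K(Y)$ from topological spaces consists of all $\mathfrak{O}\subseteq K(Y)$ whose preimage under each of these maps is open. (In the paper the map $e_{X,A}$ is written $\pi_A\circ\mu_X$, where $\mu_X: C(X,Y)\to K(Y)^{K(X)}$, $\mu_X(f)(A)=f(A)$, and $\pi_A: K(Y)^{K(X)}\to K(Y)$ is the projection to the coordinate $A$.) *)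

(* Defs.v *)
From HB Require Import structures.
From mathcomp Require Import all_boot all_classical all_analysis.

Set Implicit Arguments.
Unset Strict Implicit.
Unset Printing Implicit Defensive.

Local Open Scope classical_set_scope.

Definition compacts (X : topologicalType) : Type :=
  {A : set X | A !=set0 /\ compact A}.

Definition vietoris_subbase (Y : topologicalType) : set (set (compacts Y)) :=
  [set H | exists2 O : set Y, open O &
     H = [set B | sval B `&` O !=set0] \/ H = [set B | sval B `<=` O]].

HB.instance Definition _ (X : topologicalType) := gen_eqMixin (compacts X).
HB.instance Definition _ (X : topologicalType) := gen_choiceMixin (compacts X).
HB.instance Definition _ (X : topologicalType) :=
  isSubBaseTopological.Build (compacts X) (@vietoris_subbase X) id.

(* The library puts the compact-open topology on all functions X -> Y; the
   one on C(X, Y) is its trace. *)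
Definition cts_compact_open (X Y : topologicalType) : topologicalType :=
  initial_topology (id : continuousType X Y -> {compact-open, X -> Y}).

Lemma image_compacts_subproof (X Y : topologicalType) (f : continuousType X Y)
    (A : compacts X) : f @` sval A !=set0 /\ compact (f @` sval A).
Proof.
case: A => A [A0 cA] /=; split; first exact: image_nonempty.
by apply: continuous_compact => //; apply: continuous_subspaceT; exact: cts_fun.
Qed.

Definition image_compacts (X Y : topologicalType) (A : compacts X)
    (f : cts_compact_open X Y) : compacts Y :=
  exist _ _ (image_compacts_subproof f A).

Definition final_topology (I : Type) (S : I -> topologicalType) (Z : Type)
    (e : forall i, S i -> Z) : set (set Z) :=
  [set H | forall i, open (e i @^-1` H)].

(* The universal property of the Stone-Cech compactification, which determines
   (X, j) up to homeomorphism under D. *)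
Definition is_stone_cech (D X : topologicalType) (j : D -> X) : Prop :=
  [/\ compact [set: X], hausdorff_space X, continuous j &
    forall (K : topologicalType) (f : D -> K),
      compact [set: K] -> hausdorff_space K -> continuous f ->
      exists! g : X -> K, continuous g /\ g \o j = f].

(* Main.v *)
(* The maps e_{X,A} are Vietoris-continuous because {f | f(A) meets O} is the
   union over a in A of the subbasic sets {f | f({a}) <= O}.

   Conversely, let H be open in the final topology and K in H, with Y infinite.
   Since |Y x Y| <= |D|, there is a map (p, q) : D -> K x Y onto K x Y; let f
   extend p to X = beta D, so that f(X) = K.  As e_{X,X}^-1(H) is a
   compact-open neighbourhood of f, it contains every g such that (f x, g x)
   lies in E for all x, where E is some neighbourhood of the diagonal of K.  By
   regularity and compactness, K is covered by finitely many open V_i meeting K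
   with cl V_i x cl V_i <= E.  If L is covered by the V_i and meets all of them,
   send d to q(d) when q(d) is in L and some V_i contains both p(d) and q(d),
   and otherwise to a point of L in some V_i containing p(d).  This map is onto
   L since every p-fibre is mapped onto Y by q, and its extension g to X
   satisfies (f x, g x) in E by density of D; hence L = g(X) is in H.

   If Y is finite, it is discrete and so is K(Y). *)
Require Import Defs.
From HB Require Import structures.
From mathcomp Require Import all_boot finmap all_classical all_analysis.

Local Open Scope classical_set_scope.
Local Open Scope card_scope.

(** * Cardinal arithmetic: comparability, and squares of infinite sets *)

Lemma card_leE {T U : Type} (u0 : U) (A : set T) (B : set U) :
  A #<= B <-> exists2 f : T -> U, set_fun A B f & set_inj A f.
Proof.
rewrite -injfunPex; split=> [/card_leP[f]|[f]]; first by squash (valLR u0 f).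
exact: inj_card_le.
Qed.

(** Zorn's lemma on partial injections, encoded as graphs [R] in [A] x [B]. A maximal one is total
    on [A] or on [B]: otherwise a point missed on each side would give a pair to add. *)
Lemma card_le_total {T U : Type} (A : set T) (B : set U) : A #<= B \/ B #<= A.
Proof.
have [->|/set0P[a0 Aa0]] := eqVneq A set0; first by left; exact: card_ge0.
have [->|/set0P[b0 Bb0]] := eqVneq B set0; first by right; exact: card_ge0.
pose P (R : set (T * U)) := R `<=` A `*` B /\
  forall p q, R p -> R q -> p.1 = q.1 <-> p.2 = q.2.
have [F FP Ftot|R [[RAB Rinj] Rmax]] := @Zorn_bigcup _ P.
  split=> [p [X FX Xp]|p q [X FX Xp] [Z FZ Zq]].
    by have [XAB _] := FP _ FX; exact: XAB.
  have [XZ|ZX] := Ftot _ _ FX FZ.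
    by have [_] := FP _ FZ; apply => //; exact: XZ.
  by have [_] := FP _ FX; apply => //; exact: ZX.
have [Atot|/existsNP[a /not_implyP[Aa nRa]]] :=
    pselect (forall a, A a -> exists b, R (a, b)).
  left; apply/(card_leE b0).
  have /choice[f fR] : forall a, exists b, A a -> R (a, b).
    by move=> a; have [/Atot[b]|] := pselect (A a); [exists b|exists b0].
  exists f => [a /fR/RAB[]//|a a' /set_mem/fR Ra /set_mem/fR Ra' ff].
  exact: (Rinj _ _ Ra Ra').2.
have [Btot|/existsNP[b /not_implyP[Bb nRb]]] :=
    pselect (forall b, B b -> exists a, R (a, b)).
  right; apply/(card_leE a0).
  have /choice[f fR] : forall b, exists a, B b -> R (a, b).
    by move=> b; have [/Btot[a']|] := pselect (B b); [exists a'|exists a0].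
  exists f => [b /fR/RAB[]//|b b' /set_mem/fR Rb /set_mem/fR Rb' ff].
  exact: (Rinj _ _ Rb Rb').1.
exfalso; apply: (Rmax (R `|` [set (a, b)])).
  split; first by move=> p; left.
  by move=> /(_ (a, b) (or_intror erefl)) Rab; apply: nRa; exists b.
split=> [p [/RAB//|->//]|[x y] [x' y'] [Rp|[-> ->]] [Rq|[-> ->]]] //=.
- exact: (Rinj _ _ Rp Rq).
- by split=> e; [case: nRa; exists y; rewrite -e|case: nRb; exists x; rewrite -e].
- by split=> e; [case: nRa; exists y'; rewrite e|case: nRb; exists x'; rewrite e].
Qed.

Record square_inj {T : Type} (S : set T) (f : T * T -> T) : Prop := SquareInj {
  square_inj_infinite : infinite_set S;
  square_inj_fun : set_fun (S `*` S) S f;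
  square_inj_inj : set_inj (S `*` S) f }.

(* Two tags a <> b in S embed the disjoint union of two copies of S in S x S. *)
Lemma square_inj_setU {T : Type} (S S' : set T) (f : T * T -> T) :
  square_inj S f -> S' #<= S -> S `|` S' #<= S.
Proof.
case=> Sinf fS finj.
have [a Sa] := infinite_setN0 Sinf.
have [b [Sb /= ba]] : (S `\ a) !=set0.
  by apply: infinite_setN0; apply: infinite_setD => //; exact: finite_set1.
move=> /(card_leE a)[h hS hinj]; apply/(card_leE a).
exists (fun x => if x \in S then f (x, a) else f (h x, b)) => [x|x y].
  case: ifPn => [/set_mem Sx _|/negP nSx [/mem_set//|S'x]]; apply: fS; split=> //=.
  exact: hS.
move=> xU yU.
have sq u v : S u -> S v -> (u, v) \in S `*` S by move=> *; apply/mem_set.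
have hS' z : z \in S `|` S' -> z \notin S -> S' z.
  by move=> /set_mem[/mem_set->|].
case: ifPn => [/set_mem xS|xS]; case: ifPn => [/set_mem yS|yS].
- by move=> /(finj _ _ (sq _ _ xS Sa) (sq _ _ yS Sa))[].
- move=> /(finj _ _ (sq _ _ xS Sa) (sq _ _ (hS _ (hS' _ yU yS)) Sb))[_ e].
  by case: ba.
- move=> /(finj _ _ (sq _ _ (hS _ (hS' _ xU xS)) Sb) (sq _ _ yS Sa))[_ e].
  by case: ba.
move=> /(finj _ _ (sq _ _ (hS _ (hS' _ xU xS)) Sb)
                  (sq _ _ (hS _ (hS' _ yU yS)) Sb))[/hinj]; apply.
- by apply/mem_set; exact: hS'.
- by apply/mem_set; exact: hS'.
Qed.

(** The starting point for Zorn's lemma: [S] is a copy of the natural numbers in [T], whose pairs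
    are coded by [choice.pickle]. *)
Lemma square_inj_exists {T : Type} :
  infinite_set [set: T] -> exists S f, @square_inj T S f.
Proof.
move=> Tinf; have [t0 _] := infinite_setN0 Tinf.
have /(card_leE t0)[e _ einj] := (infiniteP [set: T]).1 Tinf.
have {}einj : injective e by move=> m n; apply: einj; rewrite in_setT.
have /choice[g gK] : forall x, exists n, range e x -> e n = x.
  by move=> x; have [[n _ <-]|] := pselect (range e x); [exists n|exists 0].
exists (range e), (fun p => e (choice.pickle (g p.1, g p.2))); split.
- by apply/infiniteP; apply/(card_leE t0); exists e => // m n _ _ /einj.
- by move=> p _; exists (choice.pickle (g p.1, g p.2)).
- move=> [x y] [x' y'] /set_mem[/= ex ey] /set_mem[/= ex' ey'].
  move=> /einj/(pcan_inj (@choice.pickleK _))[xx yy].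
  by congr (_, _); [rewrite -(gK x)// xx gK|rewrite -(gK y)// yy gK].
Qed.

(* Zorn's lemma on injections S x S -> S: in a maximal one the complement of S
   injects into S, as otherwise S could be enlarged by a disjoint copy S' of
   itself, the pairs outside S x S being sent into S'. *)
Theorem card_square {T : Type} :
  infinite_set [set: T] -> [set: T * T] #<= [set: T].
Proof.
move=> Tinf; have [t0 _] := infinite_setN0 Tinf.
pose K := {Sf : (set T * (T * T -> T))%type | square_inj Sf.1 Sf.2}.
pose R (s t : K) := `[< (sval s).1 `<=` (sval t).1 /\
  {in (sval s).1 `*` (sval s).1, (sval s).2 =1 (sval t).2} >].
have Rrefl t : R t t by apply/asboolP; split.
have Rtrans r s t : R r s -> R s t -> R r t.
  move=> /asboolP[rs ers] /asboolP[st est]; apply/asboolP; split.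
    exact: subset_trans st.
  move=> p pr; rewrite ers// est//; move/set_mem: pr => [p1 p2].
  by apply/mem_set; split; exact: rs.
have [S0 [f0 Sf0]] := square_inj_exists Tinf.
pose k0 : K := exist _ (S0, f0) Sf0.
have [C Ctot|[[S f] Sf] Smax] := @ZL_preorder _ k0 R Rrefl Rtrans.
  have [->|/set0P[c0 Cc0]] := eqVneq C set0; first by exists k0.
  have common s t : C s -> C t -> exists u, [/\ C u, R s u & R t u].
    by move=> Cs Ct; have [Rst|Rts] := Ctot _ _ Cs Ct; [exists t|exists s].
  pose U := \bigcup_(s in C) (sval s).1.
  have UC p : (U `*` U) p -> exists2 s, C s & ((sval s).1 `*` (sval s).1) p.
    case: p => x y [/= [s Cs sx] [t Ct ty]].
    have [u [Cu /asboolP[su _] /asboolP[tu _]]] := common _ _ Cs Ct.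
    by exists u => //; split; [exact: su|exact: tu].
  (* The maps of the chain are glued: any two members containing [p] in their squares agree there,
     being restrictions of a common [u]. Outside [U] x [U] the value is arbitrary. *)
  have /choice[g gP] : forall p, exists z, forall s, C s ->
      ((sval s).1 `*` (sval s).1) p -> (sval s).2 p = z.
    move=> p; have [/UC[s Cs sp]|nUp] := pselect ((U `*` U) p); last first.
      exists t0 => s Cs [sp1 sp2]; case: nUp.
      by split; exists s.
    exists ((sval s).2 p) => t Ct tp.
    have [u [Cu /asboolP[_ su] /asboolP[_ tu]]] := common _ _ Cs Ct.
    by rewrite su ?tu//; exact/mem_set.
  have Ug : square_inj U g.
    split.
    - case: (c0) Cc0 => -[S f] Sf Cc0;
      apply: sub_infinite_set (square_inj_infinite _ _ Sf) => x Sx.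
      by exists (exist _ (S, f) Sf).
    - move=> p /UC[s Cs sp]; rewrite -(gP p s Cs sp); exists s => //.
      exact: (square_inj_fun _ _ (svalP s)).
    - move=> p q /set_mem/UC[s Cs sp] /set_mem/UC[t Ct tq].
      rewrite -(gP p s Cs sp) -(gP q t Ct tq).
      have [u [Cu /asboolP[su esu] /asboolP[tu etu]]] := common _ _ Cs Ct.
      rewrite esu ?etu; [|exact/mem_set|exact/mem_set].
      apply: (square_inj_inj _ _ (svalP u)); apply/mem_set.
        by case: sp => ? ?; split; exact: su.
      by case: tq => ? ?; split; exact: tu.
  exists (exist _ (U, g) Ug) => s Cs; apply/asboolP.
  split=> /= [x sx|p /set_mem sp]; first by exists s.
  exact: gP.
have /= Sf' := Sf.
have [a Sa] := infinite_setN0 (square_inj_infinite _ _ Sf').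
have [/(card_leE t0)[h hC hinj]|CleS] := card_le_total S (~` S); last first.
  (* Here [S] together with its complement is all of [T], so [i] injects [T] into [S] and [f]
     composed with [i] x [i] is the required injection. *)
  have := square_inj_setU _ _ _ Sf' CleS; rewrite setUv.
  move=> /(card_leE t0)[i iS iinj].
  apply/(card_leE t0); exists (fun p => f (i p.1, i p.2)) => //.
  move=> [x y] [x' y'] _ _.
  have iSS u v : (i u, i v) \in S `*` S by apply/mem_set; split; exact: iS.
  move=> /(square_inj_inj _ _ Sf' _ _ (iSS _ _) (iSS _ _))[].
  by move=> /(iinj _ _ (in_setT _) (in_setT _))->
    /(iinj _ _ (in_setT _) (in_setT _))->.
pose U := S `|` h @` S.
have /(card_leE t0)[i iS iinj] := square_inj_setU _ _ _ Sf' (card_image_le h S).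
pose g p := if p \in S `*` S then f p else h (f (i p.1, i p.2)).
have iSS p : (U `*` U) p -> (S `*` S) (i p.1, i p.2).
  by move=> [? ?]; split; exact: iS.
have fiS p : (U `*` U) p -> S (f (i p.1, i p.2)).
  by move=> /iSS; exact: (square_inj_fun _ _ Sf').
have Ug : square_inj U g.
  split.
  - by apply: sub_infinite_set (square_inj_infinite _ _ Sf') => x; left.
  - move=> p Up; rewrite /g; case: ifPn => [/set_mem pS|_].
      by left; exact: (square_inj_fun _ _ Sf').
    by right; exists (f (i p.1, i p.2)) => //; exact: fiS.
  - move=> p q /set_mem Up /set_mem Uq; rewrite /g.
    case: ifPn => [pS|_]; case: ifPn => [qS|_].
    + exact: (square_inj_inj _ _ Sf').
    + move=> fh; case: (hC (f (i q.1, i q.2))); first exact: fiS.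
      by rewrite -fh; apply: (square_inj_fun _ _ Sf'); exact/set_mem.
    + move=> fh; case: (hC (f (i p.1, i p.2))); first exact: fiS.
      by rewrite fh; apply: (square_inj_fun _ _ Sf'); exact/set_mem.
    + move=> /(hinj _ _ (mem_set (fiS _ Up)) (mem_set (fiS _ Uq))).
      move=> /(square_inj_inj _ _ Sf' _ _
        (mem_set (iSS _ Up)) (mem_set (iSS _ Uq))).
      case: p q Up Uq => x y [x' y'] [/= Ux Uy] [/= Ux' Uy'] [].
      by move=> /(iinj _ _ (mem_set Ux) (mem_set Ux'))->
        /(iinj _ _ (mem_set Uy) (mem_set Uy'))->.
have /asboolP[/= US _] : R (exist _ (U, g) Ug) (exist _ (S, f) Sf).
  by apply: Smax; apply/asboolP; split=> /= [x Sx|p pS]; [left|rewrite /g pS].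
by case: (hC a Sa); apply: US; right; exists a.
Qed.

(** * The Vietoris topology and the continuity of the maps e_{X,A} *)

Lemma vietoris_hit_open {Y : topologicalType} (O : set Y) :
  open O -> open [set B : compacts Y | sval B `&` O !=set0].
Proof.
move=> oO; exists [set [set B : compacts Y | sval B `&` O !=set0]]; last first.
  by rewrite bigcup_set1.
by move=> _ ->; apply: finI_from1; exists O => //; left.
Qed.

Lemma vietoris_sub_open {Y : topologicalType} (O : set Y) :
  open O -> open [set B : compacts Y | sval B `<=` O].
Proof.
move=> oO; exists [set [set B : compacts Y | sval B `<=` O]]; last first.
  by rewrite bigcup_set1.
by move=> _ ->; apply: finI_from1; exists O => //; right.
Qed.

Lemma vietoris_continuous {Z Y : topologicalType} (e : Z -> compacts Y) :
    (forall O : set Y, open O -> open [set z | sval (e z) `&` O !=set0]) ->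
    (forall O : set Y, open O -> open [set z | sval (e z) `<=` O]) ->
  continuous e.
Proof.
move=> ehit esub; apply/continuousP => _ [D DS <-].
rewrite preimage_bigcup; apply: bigcup_open => G /DS[F FS <-].
rewrite preimage_bigcap openE => z Fz; apply: filter_bigI => W FW.
apply: open_nbhs_nbhs; split; last exact: Fz.
have := FS _ FW; rewrite inE => -[U oU [->|->]]; [exact: ehit|exact: esub].
Qed.

Lemma vietoris_nbhs {Y : topologicalType} (K : compacts Y) (I : choiceType)
    (s : {fset I}) (V : I -> set Y) :
    (forall i, i \in s -> open (V i)) ->
    (forall i, i \in s -> sval K `&` V i !=set0) ->
    sval K `<=` \bigcup_(i in [set` s]) V i ->
  \forall L \near K, sval L `<=` \bigcup_(i in [set` s]) V i /\
    forall i, i \in s -> sval L `&` V i !=set0.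
Proof.
move=> oV KV Ks; apply: filterI.
  apply: open_nbhs_nbhs.
  by split=> //; exact: vietoris_sub_open (bigcup_open _).
apply: (@filter_bigI _ _ s
  (fun i => [set L : compacts Y | sval L `&` V i !=set0])).
move=> i si; apply: open_nbhs_nbhs; split; last exact: KV.
exact: vietoris_hit_open (oV _ si).
Qed.

Lemma image_compacts_continuous {X Y : topologicalType} (A : compacts X) :
  continuous (@image_compacts X Y A).
Proof.
have sub_open (C : set X) (O : set Y) : compact C -> open O ->
    open [set f : cts_compact_open X Y | (f : X -> Y) @` C `<=` O].
  by move=> cC oO; exists [set f | f @` C `<=` O] => //; exact: compact_open_open.
apply: vietoris_continuous => O oO; last first.
  by apply: sub_open => //; case: (svalP A).
rewrite [X in open X](_ : _ = \bigcup_(a in sval A)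
    [set f : cts_compact_open X Y | (f : X -> Y) @` [set a] `<=` O]).
  by apply: bigcup_open => a _; apply: sub_open => //; exact: compact_set1.
apply/seteqP; split=> [f [_ [[a Aa <-] Ofa]]|f [a Aa fO]].
  by exists a => // _ [_ -> <-].
by exists (f a); split; [exists a|apply: fO; exists a].
Qed.

(** * Extension and density for the Stone-Cech compactification *)

Lemma set_type_compact {X : topologicalType} (A : set X) :
  compact A -> compact [set: A].
Proof.
move=> cA F FF _.
have [|x [Ax Fx]] := cA (set_val @ F) _.
  by apply: (@filterS _ F _ setT) filterT => a _; exact: set_valP.
exists (SigSub (mem_set Ax)); split=> // U V FU [_ [[W oW <-] Wx] WV].
have [_ [[a Ua <-] Wa]] : set_val @` U `&` W !=set0.
  apply: Fx; first by apply: (@filterS _ F _ U) FU => a Ua; exists a.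
  exact: open_nbhs_nbhs.
by exists a; split=> //; exact: WV.
Qed.

Lemma set_type_hausdorff {X : topologicalType} (A : set X) :
  hausdorff_space X -> hausdorff_space A.
Proof.
move=> hX a b ab; apply: val_inj; apply: hX => U V Ua Vb.
have [c [Uc Vc]] := ab _ _ (@initial_continuous _ _ set_val a U Ua)
    (@initial_continuous _ _ set_val b V Vb).
by exists (val c).
Qed.

(** As [Y] itself need not be compact, the universal property is applied to the subspace [K]; the
    map into it is continuous because [D] is discrete. *)
Lemma stone_cech_extend {D : discreteTopologicalType} {X Y : topologicalType}
    (j : D -> X) (K : set Y) (p : D -> Y) :
    is_stone_cech j -> hausdorff_space Y -> compact K -> (forall d, K (p d)) ->
  exists f : X -> Y, [/\ continuous f, f \o j = p & forall x, K (f x)].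
Proof.
move=> [_ _ _ jext] hausY cK Kp.
pose q (d : D) : K := SigSub (mem_set (Kp d)).
have cq : continuous q.
  by apply/continuousP => A _; exact: discrete_open.
have [f [[cf fj] _]] := jext K q (set_type_compact _ cK)
  (set_type_hausdorff _ hausY) cq.
exists (val \o f); split.
- by move=> x; apply: continuous_comp; [exact: cf|exact: initial_continuous].
- by apply/funext => d /=; have /= -> := congr1 (@^~ d) fj.
- by move=> x; exact: set_valP.
Qed.

(** Extending [j] within the closure of its range gives a continuous [f : X -> X] with [f \o j = j].
    The identity is another such map, so uniqueness forces [f = id]. *)
Lemma stone_cech_dense {D : discreteTopologicalType} {X : topologicalType}
    (j : D -> X) : is_stone_cech j -> closure (range j) = setT.
Proof.
move=> jX; have [cX hX cj jext] := jX.
have [f [cf fj fcl]] : exists f : X -> X,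
    [/\ continuous f, f \o j = j & forall x, closure (range j) (f x)].
  apply: stone_cech_extend => //; last by move=> d; exact: subset_closure.
  by apply: subclosed_compact cX _ => //; exact: closed_closure.
have [g [_ guniq]] := jext X j cX hX cj.
have fid : f = id.
  rewrite -(guniq f)// -(guniq id)//; split=> // x; exact: cvg_id.
by apply/seteqP; split=> // x _; rewrite -[x]/(id x) -fid.
Qed.

(** * Finite covers, maps onto K x Y, and the case of finite Y *)

Lemma compact_finite_cover {Y : topologicalType} (K : set Y) (V : Y -> set Y) :
    compact K -> (forall y, K y -> nbhs y (V y)) ->
  exists s : {fset Y}, {subset s <= K} /\ K `<=` \bigcup_(y in [set` s]) V y.
Proof.
move=> cK KV; have [->|/set0P[y0 _]] := eqVneq K set0; first by exists fset0; split.
pose Yp : ptopologicalType := HB.pack Y (isPointed.Build Y y0).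
have : @cover_compact Yp K by rewrite -(@compact_cover Yp).
move=> /(_ Y K (fun y => (V y)°))[y Ky|y Ky|s sK Ks].
- exact: open_interior.
- by exists y => //; apply: nbhs_singleton; apply: nbhs_interior; exact: KV.
- by exists s; split=> // y /Ks[z sz Vz]; exists z => //; exact: interior_subset.
Qed.

(** A left inverse [g] of an injection of [Y] x [Y] into [D] supplies both maps; first coordinates
    outside [K] are reset to [k0], which loses no pair over [K]. *)
Lemma surj_pair {D Y : Type} (K : set Y) :
    infinite_set [set: Y] -> [set: Y] #<= [set: D] -> K !=set0 ->
  exists p q : D -> Y, (forall d, K (p d)) /\
    forall y z, K y -> exists d, p d = y /\ q d = z.
Proof.
move=> Yinf YD [k0 Kk0].
have YYD := card_le_trans (card_square Yinf) YD.
have [d0 _] : [set: D] !=set0.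
  by apply: infinite_setN0 => /(card_le_finite YD).
have /(card_leE d0)[i _ iinj] := YYD.
have /choice[g gP] : forall d, exists yz : Y * Y,
    forall yz', i yz' = d -> yz' = yz.
  move=> d; have [[yz _ <-]|nd] := pselect (range i d).
    by exists yz => yz' /iinj; apply; rewrite in_setT.
  by exists (k0, k0) => yz' e; case: nd; exists yz'.
exists (fun d => if (g d).1 \in K then (g d).1 else k0), (fun d => (g d).2).
split=> [d|y z Ky]; first by case: ifPn => [/set_mem|].
by exists (i (y, z)); rewrite -(gP _ _ erefl)/= mem_set.
Qed.

Lemma finite_hausdorff_open {Y : topologicalType} (A : set Y) :
  hausdorff_space Y -> finite_set [set: Y] -> open A.
Proof.
move=> hY finY; rewrite -[A]setCK; apply: closed_openC.
apply: accessible_finite_set_closed.1; first exact: hausdorff_accessible.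
exact: sub_finite_set finY.
Qed.

Lemma compacts_eq {Y : topologicalType} (K L : compacts Y) :
  sval K = sval L -> K = L.
Proof. exact: eq_sig_hprop. Qed.

(** Singletons are open, and a set covered by the singletons of [K] and meeting each of them is
    [K]. *)
Lemma finite_vietoris_discrete {Y : topologicalType} (H : set (compacts Y)) :
  hausdorff_space Y -> finite_set [set: Y] -> open H.
Proof.
move=> hY finY; rewrite openE => K HK.
have [_ cK] := svalP K.
have [s [sK Ks]] := @compact_finite_cover Y (sval K) (fun y => [set y]) cK
  (fun y _ => open_nbhs_nbhs (conj (finite_hausdorff_open _ hY finY) erefl)).
have {}sK y : y \in s -> sval K y by move=> /sK/set_mem.
have Vo y : y \in s -> open [set y] by move=> _; exact: finite_hausdorff_open.
have KV y : y \in s -> sval K `&` [set y] !=set0 by move=> /sK Ky; exists y.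
apply: (@filterS _ (nbhs K) _ _ _ _
  (vietoris_nbhs K _ s _ Vo KV Ks)) => L [Ls LV].
suff -> : L = K by [].
apply: compacts_eq; apply/seteqP; split=> y.
  by move=> /Ls[z sz yz]; rewrite (yz : y = z); exact: sK.
move=> /Ks[z sz yz]; have [z' [Lz zz]] := LV z sz.
by rewrite (yz : y = z) -(zz : z' = z).
Qed.

(** * Compact-open neighbourhoods and neighbourhoods of the diagonal *)

Definition diagonal_on {Y : Type} (K : set Y) : set (Y * Y) :=
  [set p | K p.1 /\ p.1 = p.2].

(* A subbasic condition f(A) <= W corresponds to the neighbourhood
   {(y, z) | y in f(A) -> z in W} of the diagonal, f(A) being closed. *)
Lemma cts_compact_open_nbhs {X Y : topologicalType} (f : X -> Y) (K : set Y)
    (N : set (X -> Y)) :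
    hausdorff_space Y -> continuous f -> (forall x, K (f x)) ->
    nbhs (f : {compact-open, X -> Y}) N ->
  exists2 E, set_nbhs (diagonal_on K) E &
    [set g | forall x, E (f x, g x)] `<=` N.
Proof.
move=> hY cf Kf Nf.
(* Once the inclusion is phrased as convergence to [f] of the filter [F] generated by these sets,
   only subbasic compact-open sets have to be checked. *)
pose F : set_system {compact-open, X -> Y} :=
  filter_from (set_nbhs (diagonal_on K))
    (fun E => [set g | forall x, E (f x, g x)]).
have FF : Filter F.
  apply: filter_from_filter; first by exists setT; exact: filterT.
  move=> E E' KE KE'; exists (E `&` E'); last first.
    by move=> g gE; split=> x; case: (gE x).
  by move=> z Kz; apply: filterI; [exact: KE|exact: KE'].
suff : F --> (f : {compact-open, X -> Y}) by move=> /(_ _ Nf).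
apply/compact_open_cvgP => A W cA oW fAW.
exists [set p | (f @` A) p.1 -> W p.2]; last first.
  by move=> g gE _ [x Ax <-]; apply: gE; exists x.
move=> [y _] [/= Ky <-].
have [fAy|nfAy] := pselect ((f @` A) y).
  exists (setT, W) => /=; last by move=> [u v] [_ Wv] _.
  by split; [exact: filterT|apply: open_nbhs_nbhs; split=> //; exact: fAW].
have fAcl : closed (f @` A).
  apply: compact_closed => //; apply: continuous_compact => //.
  exact: continuous_subspaceT.
exists (~` (f @` A), setT) => /=; last by move=> [u v] [nfAu _] /nfAu.
split; last exact: filterT.
by apply: open_nbhs_nbhs; split=> //; exact: closed_openC.
Qed.

Lemma regular_square_nbhs {Y : topologicalType} (y : Y) (E : set (Y * Y)) :
  regular_space Y -> nbhs (y, y) E ->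
  exists2 V, open_nbhs y V & closure V `*` closure V `<=` E.
Proof.
move=> rY [[U U'] [/= Uy U'y] UU'E].
have [V0 V0y clV0] := rY y _ (filterI Uy U'y).
exists V0°; first split.
- exact: open_interior.
- by apply: nbhs_singleton; exact: nbhs_interior.
have V0sub z : closure V0° z -> (U `&` U') z.
  by move=> Vz; apply: clV0; apply: closure_subset Vz; exact: interior_subset.
by move=> [u v] [/V0sub[Uu _] /V0sub[_ U'v]]; exact: UU'E.
Qed.

(** * From the final topology to Vietoris neighbourhoods *)

Lemma final_vietoris_nbhs {D : discreteTopologicalType} {X Y : topologicalType}
    (j : D -> X) (X0 : [set: X] !=set0 /\ compact [set: X])
    (H : set (compacts Y)) (K : compacts Y) :
    hausdorff_space Y -> regular_space Y ->
    infinite_set [set: Y] -> [set: Y] #<= [set: D] -> is_stone_cech j ->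
    open (@image_compacts X Y (exist _ setT X0) @^-1` H) ->
  H K -> nbhs K H.
Proof.
move=> hY rY Yinf YD jX oH HK.
have [K0 cK] := svalP K.
have [p [q [Kp pq]]] := surj_pair _ Yinf YD K0.
have [f [cf fj Kf]] := stone_cech_extend j (sval K) p jX hY cK Kp.
have image_eq (L : compacts Y) (r : D -> Y) (g : X -> Y) :
    (forall x, sval L (g x)) -> g \o j = r -> sval L `<=` range r ->
    g @` setT = sval L.
  move=> Lg gj Lr; apply/seteqP; split=> [_ [x _ <-]//|z /Lr[d _ <-]].
  by exists (j d) => //; rewrite -gj.
(* The compact-open topology on C(X, Y) is a trace, so [N] is open among all functions, and its
   continuous members are those whose image lies in [H]. *)
have [N oN NH] := oH.
have NHE (L : compacts Y) (g : X -> Y) : continuous g -> g @` setT = sval L ->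
    N g = H L.
  move=> cg gL; have := NH.
  move=> /(congr1 (fun A : set (continuousType X Y) => A (mkcts cg))) /= ->.
  by congr H; exact: compacts_eq.
have Nf : nbhs (f : {compact-open, X -> Y}) N.
  apply: open_nbhs_nbhs; split=> //=; rewrite (NHE K)//.
  apply: (image_eq K p f) => // y Ky.
  by have [d [<- _]] := pq y y Ky; exists d.
have [E KE EN] := cts_compact_open_nbhs f (sval K) N hY cf Kf Nf.
have /choice[V VP] : forall y, exists V, sval K y ->
    open_nbhs y V /\ closure V `*` closure V `<=` E.
  move=> y; have [Ky|] := pselect (sval K y); last by exists setT.
  have [V Vy VE] := regular_square_nbhs y E rY (KE (y, y) (conj Ky erefl)).
  by exists V.
have [s [sK Ks]] := @compact_finite_cover _ _ V cK
  (fun y Ky => open_nbhs_nbhs (VP y Ky).1).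
have {}sK y : y \in s -> sval K y by move=> /sK/set_mem.
have Vo y : y \in s -> open (V y) by move=> /sK/VP[[]].
have KV y : y \in s -> sval K `&` V y !=set0.
  by move=> /sK Ky; exists y; split=> //; have [[]] := VP y Ky.
apply: (@filterS _ (nbhs K) _ _ _ _
  (vietoris_nbhs K _ s _ Vo KV Ks)) => L [Ls LV].
(* The second clause keeps the extension of [r] close to [f]; the third makes [r] onto [L]. *)
have /choice[r rP] : forall d, exists z,
    [/\ sval L z, exists2 y, y \in s & V y (p d) /\ V y z &
      sval L (q d) -> (exists2 y, y \in s & V y (p d) /\ V y (q d)) -> z = q d].
  move=> d.
  have [[Lq sq]|nq] := pselect (sval L (q d) /\
    exists2 y, y \in s & V y (p d) /\ V y (q d)); first by exists (q d).
  have [y sy Vp] := Ks _ (Kp d).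
  have [z [Lz Vz]] := LV _ sy.
  exists z; split=> //; first by exists y.
  by move=> *; case: nq.
have [_ cL] := svalP L.
have Lr d : sval L (r d) by case: (rP d).
have [g [cg gj Lg]] := stone_cech_extend j (sval L) r jX hY cL Lr.
rewrite -(NHE L g cg); last first.
  apply: (image_eq L r g) => // z Lz.
  have [y sy Vz] := Ls _ Lz.
  (* Over the centre [y] of a set [V y] containing [z], some [d] has [q d = z]; both values lie in
     [V y], so [r d = z]. *)
  have [d [pd qd]] := pq y z (sK _ sy).
  exists d => //; have [_ _ ->] := rP d; rewrite ?qd//.
  by exists y => //; split=> //; rewrite pd; have [[]] := VP _ (sK _ sy).
apply: EN => x.
(* Closures of the [V y] make [G] closed, as a finite union; it contains the dense range of [j],
   hence every [x]. *)
pose G := \bigcup_(y in [set` s])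
  [set x | closure (V y) (f x) /\ closure (V y) (g x)].
suff Gx : G x by have [y sy [fV gV]] := Gx; exact: (VP _ (sK _ sy)).2.
have clG : closed G.
  apply: closed_bigcup => // y sy; apply: closedI.
    by apply: preimage_closed; [|exact: closed_closure].
  by apply: preimage_closed; [|exact: closed_closure].
rewrite ((closure_id G).1 clG).
have : closure (range j) x by rewrite stone_cech_dense.
apply: closure_subset => _ [d _ <-].
have [_ [y sy [Vp Vr]] _] := rP d.
exists y => //; split; apply: subset_closure.
  by have -> : f (j d) = p d by rewrite -fj.
by have -> : g (j d) = r d by rewrite -gj.
Qed.

Theorem corollary3p7 (Y : topologicalType) (hausY : hausdorff_space Y)
    (T3Y : regular_space Y) (B : topologicalType -> Prop)
    (stone_cech_in_B :
       exists (D : discreteTopologicalType) (X : topologicalType) (j : D -> X),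
         [/\ [set: Y] #<= [set: D], is_stone_cech j & B X]) :
  @open (compacts Y) =
  final_topology
    (fun i : {X : {X : topologicalType | B X} & compacts (sval X)} =>
       @image_compacts (sval (projT1 i)) Y (projT2 i)).
Proof.
have [D [X [j [YD jX BX]]]] := stone_cech_in_B.
apply/seteqP; split=> [H oH i|H oH].
  by move/continuousP: (@image_compacts_continuous _ Y (projT2 i)); exact.
have [finY|infY] := pselect (finite_set [set: Y]).
  exact: finite_vietoris_discrete.
have [cX _ _ _] := jX.
have X0 : [set: X] !=set0.
  have [d _] : [set: D] !=set0 by apply: infinite_setN0 => /(card_le_finite YD).
  by exists (j d).
rewrite openE => K HK.
apply: (final_vietoris_nbhs j (conj X0 cX) H K) => //.
exact: (oH (existT _ (exist _ X BX) (exist _ setT (conj X0 cX)))).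
Qed.
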